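(* For every graph $G$ of order greater than $1$, we have $\textnormal{ftdim}(G) \le \dim(G)\,(2+3^{\dim(G)-1})$.
   Context: All graphs are finite, simple and undirected, and need not be connected; $\textnormal{dist}(u,v)=\infty$ if $u,v$ lie in different components. A set $S=\{v_1,\dots,v_k\}$ of vertices (with a fixed order) is a resolving set of $G$ if the vectors $d_S(u)=(\textnormal{dist}(u,v_1),\dots,\textnormal{dist}(u,v_k))$ are pairwise distinct over all $u\in V(G)$. The metric dimension $\dim(G)$ is the minimum size of a resolving set. The fault-tolerant metric dimension $\textnormal{ftdim}(G)$ is the minimum size of a nonempty set $S\subseteq V(G)$ such that $S-\{s\}$ is a resolving set of $G$ for every $s\in S$. *)

(* Defs.v *)
From mathcomp Require Import all_boot.
Set Implicit Arguments.
Unset Strict Implicit.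
Unset Printing Implicit Defensive.

Section MetricDimension.

(* The graph with vertex set T and adjacency relation e; symmetry and
   irreflexivity of e are hypotheses of the theorems. *)
Variables (T : finType) (e : rel T).
Implicit Types (u v s : T) (S : {set T}) (n : nat).

Definition has_walk u v n : bool :=
  [exists p : n.-tuple T, path e u p && (last u p == v)].

(* Values in option nat, with None for infinity: a shortest walk has fewer
   than #|T| edges, so the search below fails only when v is not reachable
   from u (see dist_SomeP and dist_NoneP). *)
Definition dist u v : option nat :=
  let n := find (has_walk u v) (iota 0 #|T|) in
  if n < #|T| then Some n else None.

(* The fixed order on S is the one of enum S. *)
Definition dist_vector S u : seq (option nat) := [seq dist u v | v <- enum S].

Definition resolving S : bool := injectiveb (dist_vector S).

Definition fault_tolerant S : bool :=
  (S != set0) && [forall s in S, resolving (S :\ s)].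

(* The default [set: T] of both minima is itself admissible, for
   fault_tolerant as soon as T is nonempty (see resolving_setT and
   fault_tolerant_setT). *)
Definition mdim : nat := #|[arg min_(S < [set: T] | resolving S) #|S| ]|.

Definition ftdim : nat := #|[arg min_(S < [set: T] | fault_tolerant S) #|S| ]|.

Lemma has_walkP u v n :
  reflect (exists p, [/\ path e u p, last u p = v & size p = n])
          (has_walk u v n).
Proof.
apply: (iffP existsP) => [[p /andP[ep /eqP lp]]|[p [ep lp /eqP sp]]].
  by exists p; rewrite size_tuple.
by exists (Tuple sp); rewrite /= ep lp eqxx.
Qed.

Lemma has_walk_short u v n :
  has_walk u v n -> exists2 m, m < #|T| & has_walk u v m && (m <= n).
Proof.
case/has_walkP=> p [ep lp sp]; have := lp; case/shortenP: ep => q eq uq subq lq.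
exists (size q); first by rewrite -[(size q).+1]/(size (u :: q)) -(card_uniqP uq) max_card.
apply/andP; split; first by apply/has_walkP; exists q.
by rewrite -sp; apply: uniq_leq_size => //; case/andP: uq.
Qed.

Lemma dist_SomeP u v n :
  reflect (has_walk u v n /\ forall m, has_walk u v m -> n <= m)
          (dist u v == Some n).
Proof.
rewrite /dist; set k := find _ _.
have before m : m < k -> has_walk u v m = false.
  move=> mk; have := before_find 0 mk; rewrite nth_iota //.
  by apply: leq_trans mk _; rewrite -[X in _ <= X](size_iota 0 #|T|) find_size.
have minK m : has_walk u v m -> k <= m by move=> w; rewrite leqNgt; apply/negP => /before; rewrite w.
case: ifP => kT.
  have wk : has_walk u v k.
    have h : has (has_walk u v) (iota 0 #|T|) by rewrite has_find size_iota.
    by have := nth_find 0 h; rewrite nth_iota.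
  apply: (iffP eqP) => [[<-]|[wn minn]]; first by split.
  by congr Some; apply/eqP; rewrite eqn_leq minK // minn.
apply: (iffP idP) => // -[/has_walk_short[m mT /andP[wm _]] _].
by have := leq_ltn_trans (minK _ wm) mT; rewrite kT.
Qed.

Lemma dist_NoneP u v : reflect (~~ connect e u v) (dist u v == None).
Proof.
apply: (iffP eqP) => [E|ncon].
  apply/negP => /connectP[p ep lp].
  have ex : exists n, has_walk u v n.
    by exists (size p); apply/has_walkP; exists p.
  case: (ex_minnP ex) => n wn minn.
  by have := introT (dist_SomeP u v n) (conj wn minn); rewrite E.
case E: (dist u v) => [n|//].
have /dist_SomeP[/has_walkP[p [ep lp _]] _] := introT eqP E.
by case/negP: ncon; apply/connectP; exists p.
Qed.

Lemma dist_eq0 u v : (dist u v == Some 0) = (u == v).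
Proof.
apply/dist_SomeP/eqP => [[/has_walkP[p [_ lp /size0nil p0]] _]|->].
  by move: lp; rewrite p0.
by split=> //; apply/has_walkP; exists [::].
Qed.

Lemma resolvingP S :
  reflect (forall u v, {in S, forall s, dist u s = dist v s} -> u = v)
          (resolving S).
Proof.
apply: (iffP (injectiveP _)) => inj u v h; apply: inj.
  by apply/eq_in_map => s; rewrite mem_enum; apply: h.
by move=> s sS; move/eq_in_map: h => /(_ s); rewrite mem_enum; apply.
Qed.

Lemma resolving_setT : resolving [set: T].
Proof.
apply/resolvingP => u v /(_ v (in_setT v)) h.
by apply/eqP; rewrite -dist_eq0 h dist_eq0.
Qed.

Lemma fault_tolerant_setT : 0 < #|T| -> fault_tolerant [set: T].
Proof.
rewrite /fault_tolerant -card_gt0 cardsT => -> /=.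
apply/forall_inP => s _; apply/resolvingP => u v h; apply/eqP.
case: (eqVneq v s) h => [->|vs] h; last first.
  by rewrite -dist_eq0 h ?inE ?vs // dist_eq0.
apply: contraT => us; have := dist_eq0 s u.
by rewrite -h ?inE ?us // dist_eq0 eqxx eq_sym (negbTE us).
Qed.

End MetricDimension.

(* Main.v *)
Require Import Defs.
From mathcomp Require Import all_boot.
Set Implicit Arguments.
Unset Strict Implicit.
Unset Printing Implicit Defensive.

(** Let [S] be a resolving set of minimum size [k].  Enlarge it by adding, for
    each [v] in [S], the neighbours of [v] and the vertices [w <> v] which
    have the same distances as [v] to [S - v] and are adjacent to every
    neighbour of [v].

    The result is fault tolerant: suppose that [v] in [S] is removed and that,
    in [S], only [v] resolved a pair [u], [w], with [d(u,v) < d(w,v)].  If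
    [u <> v], the neighbour of [v] on a shortest path to [u] resolves the pair.
    If [u = v], then either some neighbour of [v] resolves it, or [w] was added
    to the set and does so itself.

    Each [v] contributes at most [2 + 3 ^ (k - 1)] vertices.  Its neighbours
    are at distance 1 from [v], and their distances to any other [s] in [S]
    differ from [d(v,s)] by at most 1, so there are at most [3 ^ (k - 1)] of
    them.  The added twins [w] have the same distances to [S - v], and are all
    at distance 2 from [v] (or infinity if [v] is isolated), so there is at
    most one of them. *)

Section FaultTolerance.

Variables (T : finType) (e : rel T).
Hypotheses (e_sym : symmetric e) (e_irr : irreflexive e).
Implicit Types (u v w x s : T) (S : {set T}) (n : nat).

(* Infinity is encoded by [#|T|], which exceeds every finite distance. *)
Definition ndist u v : nat := odflt #|T| (dist e u v).

Lemma ndist_le_card u v : ndist u v <= #|T|.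
Proof. by rewrite /ndist /dist; case: ifP => //= /ltnW. Qed.

(** Finite distances are below [#|T|], so this encoding of infinity loses no information. *)
Lemma ndist_inj u v u' v' : ndist u v = ndist u' v' -> dist e u v = dist e u' v'.
Proof.
rewrite /ndist /dist.
case: ifP => /= h1; case: ifP => /= h2 E //; first by rewrite E.
  by rewrite E ltnn in h1.
by rewrite -E ltnn in h2.
Qed.

Lemma ndist_walk_le u v n : has_walk e u v n -> ndist u v <= n.
Proof.
move=> w; rewrite /ndist; case E: (dist e u v) => [m|] /=.
  by have /dist_SomeP[_ ->] := introT eqP E.
have /dist_NoneP/negP[] := introT eqP E.
by case/has_walkP: w => p [ep lp _]; apply/connectP; exists p.
Qed.

Lemma ndist_walk u v : ndist u v < #|T| -> has_walk e u v (ndist u v).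
Proof.
rewrite /ndist; case E: (dist e u v) => [m|] /=; last by rewrite ltnn.
by have /dist_SomeP[] := introT eqP E.
Qed.

Lemma ndist_eq0 u v : (ndist u v == 0) = (u == v).
Proof.
rewrite -(dist_eq0 e) /ndist; case: (dist e u v) => [m|] //=.
by apply/negbTE; rewrite -lt0n; apply/card_gt0P; exists u.
Qed.

Lemma ndistxx u : ndist u u = 0.
Proof. by apply/eqP; rewrite ndist_eq0. Qed.

Lemma has_walk_sym u v n : has_walk e u v n -> has_walk e v u n.
Proof.
case/has_walkP => p [ep lp sp]; apply/has_walkP.
exists (rev (belast u p)); split.
- rewrite -lp rev_path; apply: sub_path ep => x y /=.
  by rewrite e_sym.
- by case: p ep lp sp => [|y p] //= _ _ _; rewrite rev_cons last_rcons.
- by rewrite size_rev size_belast.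
Qed.

Lemma ndistC u v : ndist u v = ndist v u.
Proof.
suff le x y : ndist x y <= ndist y x by apply/eqP; rewrite eqn_leq !le.
have [h|h] := ltnP (ndist y x) #|T|.
  exact/ndist_walk_le/has_walk_sym/ndist_walk.
exact: leq_trans (ndist_le_card _ _) h.
Qed.

(** Append the edge to a shortest walk; if [v] is unreachable from [u], the bound holds because no
    value exceeds [#|T|]. *)
Lemma ndist_edge u v x : e v x -> ndist u x <= (ndist u v).+1.
Proof.
move=> evx; have [h|h] := ltnP (ndist u v) #|T|; last first.
  exact: leq_trans (ndist_le_card _ _) (leqW h).
have /has_walkP[p [ep lp sp]] := ndist_walk h.
apply/ndist_walk_le/has_walkP; exists (rcons p x).
by rewrite rcons_path ep lp evx last_rcons size_rcons sp.
Qed.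

(** The witness is the penultimate vertex of a shortest walk from [u] to [v]. *)
Lemma ndist_pred u v :
  u != v -> ndist u v < #|T| -> exists2 x, e v x & (ndist u x).+1 <= ndist u v.
Proof.
rewrite -ndist_eq0 => uv h; have /has_walkP[p [ep lp sp]] := ndist_walk h.
case/lastP: p ep lp sp => [|p y]; first by move=> _ _ E; rewrite -E in uv.
rewrite rcons_path last_rcons size_rcons => /andP[ep epy] yv <-.
exists (last u p); first by rewrite e_sym -yv.
by rewrite ltnS; apply/ndist_walk_le/has_walkP; exists p.
Qed.

Lemma ndist_eq1 u v : (ndist u v == 1) = e u v.
Proof.
apply/eqP/idP => [E|euv]; last first.
  have := ndist_edge u euv; rewrite ndistxx.
  case E: (ndist u v) => [|[|n]] // _.
  by move/eqP: E euv; rewrite ndist_eq0 => /eqP ->; rewrite e_irr.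
have uv : u != v by rewrite -ndist_eq0 E.
(* Hence the value 1 does not encode infinity. *)
have T1 : 1 < #|T|.
  by rewrite -(cardC (pred2 u v)) card2 uv.
have [|x evx] := ndist_pred uv; first by rewrite E.
by rewrite E ltnS leqn0 ndist_eq0 => /eqP ->; rewrite e_sym.
Qed.

Lemma resolving_ndistP S :
  reflect (forall u v, {in S, forall s, ndist u s = ndist v s} -> u = v)
          (resolving e S).
Proof.
apply: (iffP (resolvingP _ _)) => inj u v h; apply: inj => s sS.
  exact/ndist_inj/h.
by rewrite /ndist h.
Qed.

Lemma resolving_subset S1 S2 :
  S1 \subset S2 -> resolving e S1 -> resolving e S2.
Proof.
move=> /subsetP sub /resolvingP r; apply/resolvingP => u v h.
by apply: r => s /sub; apply: h.
Qed.

Definition nbhd v : {set T} := [set x | e v x].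

Definition twins S v : {set T} :=
  [set w | [&& w != v, [forall s in S :\ v, ndist w s == ndist v s]
             & nbhd v \subset nbhd w]].

Lemma card_nbhd_resolving S v :
  resolving e S -> v \in S -> #|nbhd v| <= 3 ^ (#|S| - 1).
Proof.
move=> /resolving_ndistP r vS.
(* For a neighbour [x] of [v], adding 1 before subtracting avoids truncation and sends the possible
   differences -1, 0, 1 to 0, 1, 2. *)
pose code x := [ffun s : {s | s \in S :\ v} =>
  inord ((ndist x (val s)).+1 - ndist v (val s)) : 'I_3].
have inj : {in nbhd v &, injective code}.
  move=> x y; rewrite !inE => evx evy /ffunP E; apply: r => s sS.
  have [->|sv] := eqVneq s v.
    by transitivity 1; [|symmetry]; apply/eqP; rewrite ndist_eq1 e_sym.
  have sD : s \in S :\ v by rewrite !inE sv.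
  have near z : e v z -> ndist v s <= (ndist z s).+1 /\ ndist z s <= (ndist v s).+1.
    move=> evz; rewrite !(ndistC _ s); split; apply: ndist_edge => //.
    by rewrite e_sym.
  have [[x1 x2] [y1 y2]] := (near x evx, near y evy).
  have /(congr1 (@nat_of_ord 3)) := E (Sub s sD); rewrite !ffunE /=.
  rewrite !inordK ?ltnS ?leq_subLR ?addn2 ?ltnS //.
  move/(congr1 (addn^~ (ndist v s))); rewrite !subnK //.
  by case.
rewrite -(card_in_imset inj) (leq_trans (max_card _)) // card_ffun card_ord.
by rewrite card_sig (cardsD1 v S) vS add1n subn1.
Qed.

Lemma twins_ndist S v w :
  w \in twins S v -> ndist w v = if nbhd v == set0 then #|T| else 2.
Proof.
rewrite inE => /and3P[wv _ /subsetP sub]; case: ifP => [/eqP N0|/negbT/set0Pn[x xN]].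
  apply/eqP; rewrite eqn_leq ndist_le_card leqNgt; apply/negP => h.
  by have [x evx _] := ndist_pred wv h; have := in_set0 x; rewrite -N0 inE evx.
have ewx : e w x by have := sub x xN; rewrite inE.
have n1 : ndist w v != 1.
  (* If [w] were a neighbour of [v], the inclusion [sub] would make it adjacent to itself. *)
  rewrite ndist_eq1 e_sym; apply/negP => evw.
  by have := sub w; rewrite !inE evw e_irr => /(_ isT).
have exv : e x v by move: xN; rewrite inE e_sym.
have := ndist_edge w exv; have /eqP-> : ndist w x == 1 by rewrite ndist_eq1.
move: n1; rewrite -ndist_eq0 in wv.
by case: (ndist w v) wv => [|[|[|n]]].
Qed.

Lemma card_twins S v : resolving e S -> #|twins S v| <= 1.
Proof.
move=> /resolving_ndistP r; apply/card_le1_eqP => w1 w2 w1t w2t.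
apply: r => s sS.
have [->|sv] := eqVneq s v; first by rewrite (twins_ndist w1t) (twins_ndist w2t).
have agree w : w \in twins S v -> ndist w s = ndist v s.
  rewrite inE => /and3P[_ /forall_inP h _].
  by apply/eqP/h; rewrite !inE sv.
by rewrite !agree.
Qed.

Definition ft_extension S : {set T} :=
  \bigcup_(v in S) (v |: (nbhd v :|: twins S v)).

Lemma card_ft_extension S :
  resolving e S -> #|ft_extension S| <= #|S| * (2 + 3 ^ (#|S| - 1)).
Proof.
move=> r; rewrite -sum_nat_const /ft_extension.
apply: (@leq_trans (\sum_(v in S) #|v |: (nbhd v :|: twins S v)|)).
  elim/big_ind2: _ => [|A m B n Am Bn|//]; first by rewrite cards0.
  by rewrite (leq_trans (leq_card_setU _ _)) ?leq_add.
(* The summand 2 accounts for [v] and at most one twin. *)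
apply: leq_sum => v vS; rewrite cardsU1 -addn1 -addnA leq_add ?leq_b1 //.
rewrite addnC (leq_trans (leq_card_setU _ _)) // leq_add ?card_twins //.
exact: card_nbhd_resolving.
Qed.

Lemma sub_ft_extension S : S \subset ft_extension S.
Proof. by apply/subsetP => v vS; apply/bigcupP; exists v; rewrite ?setU11. Qed.

Lemma ft_extension_fault_tolerant S :
  S != set0 -> resolving e S -> fault_tolerant e (ft_extension S).
Proof.
move=> S0 r; have sub := sub_ft_extension S; apply/andP; split.
  by apply: contraNneq S0 => E; rewrite E subset0 in sub.
apply/forall_inP => v _; have [vS|vS] := boolP (v \in S); last first.
  by apply: resolving_subset r; rewrite subsetD1 sub.
have inN x : e v x -> x \in ft_extension S :\ v.
  move=> evx; rewrite !inE; apply/andP; split.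
    by apply: contraTneq evx => ->; rewrite e_irr.
  by apply/bigcupP; exists v; rewrite // !inE evx orbT.
have inS s : s \in S -> s != v -> s \in ft_extension S :\ v.
  by move=> sS sv; rewrite !inE sv (subsetP sub).
(* The hypothesis is symmetric in [u] and [w], so excluding one strict inequality yields equality of
   the distances to [v]. *)
have no_lt u w : {in ft_extension S :\ v, forall s, ndist u s = ndist w s} ->
    ~~ (ndist u v < ndist w v).
  move=> E; apply/negP => lt.
  have [uv|uv] := eqVneq u v; last first.
    (* The distance from [u] to [v] is finite, being strictly below another value of [ndist]. *)
    have [x evx] := ndist_pred uv (leq_trans lt (ndist_le_card _ _)).
    rewrite (E _ (inN _ evx)) => le.
    have := @ndist_edge w x v; rewrite e_sym evx => /(_ isT) le'.
    by have := leq_trans lt (leq_trans le' le); rewrite ltnn.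
  subst u; move: lt; rewrite ndistxx lt0n ndist_eq0 => wv.
  have wt : w \in twins S v.
    rewrite inE wv /=; apply/andP; split.
      by apply/forall_inP => s /setD1P[sv sS]; rewrite E ?inS.
    apply/subsetP => x; rewrite !inE => evx.
    by rewrite -ndist_eq1 -E ?inN // ndist_eq1.
  have /E : w \in ft_extension S :\ v.
    by rewrite !inE wv; apply/bigcupP; exists v; rewrite // !in_setU wt !orbT.
  by rewrite ndistxx => /eqP; rewrite ndist_eq0 eq_sym (negbTE wv).
apply/resolving_ndistP => u w E; apply: (elimT (resolving_ndistP _) r) => s sS.
have [->|sv] := eqVneq s v; last by rewrite E ?inS.
apply/eqP; rewrite eqn_leq leqNgt no_lt /= => [|x xS]; last by rewrite E.
by rewrite leqNgt no_lt.
Qed.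

(** Over the empty set all distance vectors coincide. This supplies the nonemptiness that
    [fault_tolerant] demands. *)
Lemma resolving_neq0 S : 1 < #|T| -> resolving e S -> S != set0.
Proof.
move=> /card_gt1P[x [y [_ _ xy]]] /resolvingP r.
by apply: contraNneq xy => S0; apply/eqP/r => s; rewrite S0 inE.
Qed.

End FaultTolerance.

Theorem theorem5 (T : finType) (e : rel T)
  (e_sym : symmetric e) (e_irr : irreflexive e) (T_gt1 : 1 < #|T|) :
  ftdim e <= mdim e * (2 + 3 ^ (mdim e - 1)).
Proof.
rewrite /mdim; case: arg_minnP => [|S r _]; first exact: resolving_setT.
apply: leq_trans (card_ft_extension e_sym e_irr r).
rewrite /ftdim; case: arg_minnP => [|F _]; last apply.
  exact/fault_tolerant_setT/ltnW.
exact/ft_extension_fault_tolerant/r/resolving_neq0/r.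
Qed.
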